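(* Let $\mathcal H=\mathcal H_1\otimes\cdots\otimes\mathcal H_m$ be a tensor product of $m$ finite-dimensional complex Hilbert spaces with $\dim\mathcal H=d$, let $1\le k\le m$ and $n=m-k+1$. Let $\widetilde\eta_m^2=\{p_b,\rho_b\}_{b=1,2}$ be an ensemble of two $m$-partite density operators on $\mathcal H$, one of which is $k$-separable, labelled so that $\rho_2$ is $k$-separable, and let $\boldsymbol R_1=R_n(\rho_1\|\tfrac{I_d}{d})$ be the random robustness of $n$-entanglement of the other state $\rho_1$. Let $\epsilon_{\widetilde\eta_m^2}=\{p_b,\sigma_b\}_{b=1,2}$ be the closest ensemble of $k$-separable states to $\widetilde\eta_m^2$. Then the optimal probabilities of global discrimination satisfy $$P_G(\widetilde\eta_m^2)-P_G(\epsilon_{\widetilde\eta_m^2})\ge\frac{\tfrac12\boldsymbol R_1}{1+\boldsymbol R_1}\left(\|p_1\rho_1-p_2\rho_2\|_1-1\right).$$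
   Context: Ensembles: $\{p_b,\rho_b\}_{b=1,2}$ means states $\rho_1,\rho_2$ occurring with probabilities $p_1,p_2\ge 0$, $p_1+p_2=1$. The trace norm is $\|A\|_1=\operatorname{Tr}\sqrt{A^\dagger A}$. $k$-separability: a pure state of $\mathcal H$ is $k$-separable if it is a tensor product of $k$ pure states (each belonging to one block of some partition of the $m$ parties into $k$ nonempty blocks). A density operator on $\mathcal H$ is $k$-separable if it is a convex mixture of $k$-separable pure states (the partition may vary between the terms). The set of $k$-separable density operators is $\mathcal M_k$. Throughout $n=m-k+1$. Random robustness of $n$-entanglement: for a density operator $\rho$ on $\mathcal H$, $R_n(\rho\|\tfrac{I_d}{d})$ is the minimum $r\ge 0$ such that $\frac{\rho+r I_d/d}{1+r}\in\mathcal M_k$, where $I_d$ is the identity on $\mathcal H$. This minimum is finite (and is $0$ when $\rho$ is $k$-separable). Closest $k$-separable ensemble: with $\boldsymbol R_b=R_n(\rho_b\|\tfrac{I_d}{d})$, set $\sigma_b=\frac{\rho_b+\boldsymbol R_b I_d/d}{1+\boldsymbol R_b}$; the closest ensemble of $k$-separable states to $\{p_b,\rho_b\}$ is $\{p_b,\sigma_b\}$. Global discrimination: for an ensemble $\{p_b,\tau_b\}_{b=1,2}$, $P_G=\max\sum_{b} p_b\operatorname{Tr}[M_b\tau_b]$, the maximum being over all POVMs $\{M_1,M_2\}$ on $\mathcal H$ ($M_b\ge0$, $M_1+M_2=I_d$); equivalently $P_G=\frac12\left(1+\|p_1\tau_1-p_2\tau_2\|_1\right)$. *)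

(* Defs.v *)
(* Complex numbers are R[i] for R : realType. *)
From mathcomp Require Import all_boot all_order all_algebra.
From mathcomp Require Import spectral.
From mathcomp Require Import all_classical all_reals.
From mathcomp Require Export complex.

Set Implicit Arguments.
Unset Strict Implicit.
Unset Printing Implicit Defensive.

Import Order.TTheory GRing.Theory Num.Theory.
Local Open Scope classical_set_scope.
Local Open Scope ring_scope.
Local Open Scope complex_scope.
Local Open Scope sesquilinear_scope.

(* The product basis of \bigotimes_(i : I) C^(dd i): one basis label per site.
   Vectors and operators on that space are indexed by 'I_#|basis dd|, the
   translation to basis labels being enum_rank / enum_val. *)
Definition basis (I : finType) (dd : I -> nat) : finType :=
  {dffun forall i : I, 'I_(dd i)}.

Notation ket R dd := 'cV[R[i]]_#|basis dd|.
Notation operator R dd := 'M[R[i]]_#|basis dd|.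

Section Operators.
Variables (R : realType) (N : nat).
Implicit Types (A : 'M[R[i]]_N) (v : 'cV[R[i]]_N).

(* In R[i], 0 <= z means that z is real and nonnegative, so this forces A to
   be Hermitian. *)
Definition psdmx A : Prop := forall v, 0 <= (v ^t* *m A *m v) 0 0.

Definition density A : Prop := psdmx A /\ \tr A = 1.

Definition unit_ket v : Prop := (v ^t* *m v) 0 0 = 1.

Definition pure v : 'M[R[i]]_N := v *m v ^t*.

(* The square root by functional calculus; meaningful for A psd. *)
Definition sqrtmx A : 'M[R[i]]_N :=
  invmx (spectralmx A) *m diag_mx (map_mx sqrtC (spectral_diag A))
    *m spectralmx A.

Definition trace_norm A : R := complex.Re (\tr (sqrtmx (A ^t* *m A))).

Definition POVM (M : 'I_2 -> 'M[R[i]]_N) : Prop :=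
  (forall b, psdmx (M b)) /\ \sum_b M b = 1%:M.

(* The value sum_b p_b Tr[M_b tau_b] is real for a POVM and an ensemble, so
   nothing is lost by taking its real part. *)
Definition success_probability (p : 'I_2 -> R) (tau : 'I_2 -> 'M[R[i]]_N)
    (M : 'I_2 -> 'M[R[i]]_N) : R :=
  complex.Re (\sum_b (p b)%:C * \tr (M b *m tau b)).

Definition P_G (p : 'I_2 -> R) (tau : 'I_2 -> 'M[R[i]]_N) : R :=
  sup [set success_probability p tau M | M in [set M | POVM M]].

(* The labels b = 1, 2 are ord0, ord_max : 'I_2. *)
Definition ensemble (p : 'I_2 -> R) (tau : 'I_2 -> 'M[R[i]]_N) : Prop :=
  [/\ forall b, 0 <= p b, \sum_b p b = 1 & forall b, density (tau b)].

(* (rho + r I/d) / (1 + r), where d = N is the dimension of the space. *)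
Definition white_noise_mix A (r : R) : 'M[R[i]]_N :=
  ((1 + r)^-1)%:C *: (A + (r / N%:R)%:C *: 1%:M).

Lemma sqrtmxK A : A \is normalmx -> sqrtmx A *m sqrtmx A = A.
Proof.
move=> /orthomx_spectralP {3}->; rewrite /sqrtmx !mulmxA.
rewrite mulmxK ?spectral_unit // -[in LHS](mulmxA (invmx _)) mulmx_diag.
by congr (_ *m diag_mx _ *m _); apply/rowP => j; rewrite !mxE -expr2 sqrtCK.
Qed.

End Operators.

Section Separability.
Variables (R : realType) (m : nat) (dd : 'I_m -> nat).

Definition block_dims (A : {set 'I_m}) (i : {i : 'I_m | i \in A}) : nat :=
  dd (val i).

Definition restrict_basis (A : {set 'I_m}) (x : basis dd) :
    basis (@block_dims A) :=
  [ffun i : {i : 'I_m | i \in A} => x (val i) : 'I_(block_dims i)].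

(* \bigotimes_(A in P) phi_A, written in the product basis. *)
Definition block_tensor (P : {set {set 'I_m}})
    (phi : forall A : {set 'I_m}, ket R (@block_dims A)) : ket R dd :=
  \col_j \prod_(A in P)
    phi A (enum_rank (restrict_basis A (enum_val j))) 0.

Definition ksep_ket (k : nat) (psi : ket R dd) : Prop :=
  exists (P : {set {set 'I_m}})
         (phi : forall A : {set 'I_m}, ket R (@block_dims A)),
    [/\ finset.partition P [set: 'I_m]%SET, #|P| = k,
        forall A, A \in P -> unit_ket (phi A)
      & psi = block_tensor P phi].

Definition ksep (k : nat) (rho : operator R dd) : Prop :=
  exists (l : nat) (w : 'I_l -> R) (psi : 'I_l -> ket R dd),
    [/\ forall j, 0 <= w j, \sum_j w j = 1, forall j, ksep_ket k (psi j)
      & rho = \sum_j (w j)%:C *: pure (psi j)].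

(* Robustness of n-entanglement is the one relative to k-separable states
   with n = m - k + 1, that is k = m - n + 1. *)
Definition robustness_set (n : nat) (rho : operator R dd) : set R :=
  [set r | 0 <= r /\ ksep (m - n + 1) (white_noise_mix rho r)].

Definition random_robustness (n : nat) (rho : operator R dd) : R :=
  inf (robustness_set n rho).

Definition closest_ksep (n : nat) (rho : operator R dd) : operator R dd :=
  white_noise_mix rho (random_robustness n rho).

End Separability.

(* P_G and random_robustness are a maximum and a minimum, taken with the
   library's sup and inf; these coincide as soon as the extremum is attained. *)
Lemma P_G_max (R : realType) N p (tau : 'I_2 -> 'M[R[i]]_N) M :
  POVM M ->
  (forall M', POVM M' ->
     success_probability p tau M' <= success_probability p tau M) ->
  P_G p tau = success_probability p tau M.
Proof.
move=> MP Mmax; apply/eqP; rewrite eq_le; apply/andP; split.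
  by apply: ge_sup; [exists (success_probability p tau M), M
                       | move=> _ [M' M'P <-]; exact: Mmax].
apply: ub_le_sup; last by exists M.
by exists (success_probability p tau M) => _ [M' M'P <-]; exact: Mmax.
Qed.

Lemma random_robustness_min (R : realType) m (dd : 'I_m -> nat) n
    (rho : operator R dd) r :
  robustness_set n rho r -> (forall s, robustness_set n rho s -> r <= s) ->
  random_robustness n rho = r.
Proof.
move=> rS rmin; apply/eqP; rewrite eq_le; apply/andP; split.
  by apply: ge_inf => //; exists r => s; exact: rmin.
by apply: lb_le_inf; [exists r | move=> s; exact: rmin].
Qed.

(* Main.v *)
(* For any POVM, the success probability on {p_b, sigma_b} is the mixture, with
   weights 1/(1+R1) and R1/(1+R1), of the success probabilities on
   {p_b, rho_b} and on {p_1, I/d; p_2, rho_2}, because sigma_2 = rho_2.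
   Bounding the latter by 1 gives
   P_G(sigma) <= (P_G(rho) + R1) / (1 + R1), and it remains to insert the
   easy half of Helstrom's formula, P_G(rho) >= (1 + ||p_1 rho_1 - p_2 rho_2||_1) / 2,
   which the projector onto the positive eigenspaces of p_1 rho_1 - p_2 rho_2
   achieves. *)
Require Import Defs.
From mathcomp Require Import all_boot all_order all_algebra.
From mathcomp Require Import all_classical all_reals.
From mathcomp Require Import spectral lra.

Set Implicit Arguments.
Unset Strict Implicit.
Unset Printing Implicit Defensive.

Import Order.TTheory GRing.Theory Num.Theory.

Local Open Scope ring_scope.
Local Open Scope complex_scope.

(* Similarity amounts to a_i W_ij = W_ij b_j for W = U V^-1, so a_i = b_j
   wherever W_ij != 0.  This makes the functional calculus in sqrtmx
   independent of the chosen diagonalization. *)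
Lemma diag_similar_map (F : fieldType) n (U V : 'M[F]_n) (a b : 'rV_n)
    (f : F -> F) :
  U \in unitmx -> V \in unitmx ->
  invmx U *m diag_mx a *m U = invmx V *m diag_mx b *m V ->
  invmx U *m diag_mx (map_mx f a) *m U = invmx V *m diag_mx (map_mx f b) *m V.
Proof.
move=> Uu Vu.
have sim c d : invmx U *m diag_mx c *m U = invmx V *m diag_mx d *m V <->
    diag_mx c *m (U *m invmx V) = U *m invmx V *m diag_mx d.
  split; [move=> /(congr1 (fun X => U *m X *m invmx V))|
    move=> /(congr1 (fun X => invmx U *m X *m V))].
    by rewrite !mulmxA mulmxV // mul1mx mulmxK.
  by rewrite !mulmxA mulVmx // mul1mx mulmxKV.
move=> /sim/matrixP eqW; apply/sim/matrixP => i j.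
move: (eqW i j); rewrite !mul_diag_mx !mul_mx_diag !mxE.
have [->|W0] := eqVneq (\sum_j0 U i j0 * invmx V j0 j) 0.
  by rewrite !mulr0 !mul0r.
by rewrite mulrC => /(mulfI W0) ->; rewrite mulrC.
Qed.

(** * Positive operators, spectral calculus and the trace norm *)

Section PositiveOperators.
Local Open Scope sesquilinear_scope.
Variables (R : realType) (N : nat).
Implicit Types (A B M : 'M[R[i]]_N) (v : 'cV[R[i]]_N).

Lemma trmxC_mul m n q (A : 'M[R[i]]_(m, n)) (B : 'M[R[i]]_(n, q)) :
  (A *m B) ^t* = B ^t* *m A ^t*.
Proof. by rewrite trmx_mul map_mxM. Qed.

Lemma spectral_decomp A : A \is normalmx ->
  A = (spectralmx A) ^t* *m diag_mx (spectral_diag A) *m spectralmx A.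
Proof.
by move=> /orthomx_spectralP {1}->; rewrite invmx_unitary ?spectral_unitarymx.
Qed.

(** Evaluating the form at the orthonormal eigenvectors of [A] reads off every eigenvalue. *)
Lemma normal_quadratic_eq0 A : A \is normalmx ->
  (forall v, (v ^t* *m A *m v) 0 0 = 0) -> A = 0.
Proof.
move=> An A0; rewrite [A]spectral_decomp //.
set V := spectralmx A; have VV : V *m V ^t* = 1%:M.
  by apply/unitarymxP/spectral_unitarymx.
suff -> : spectral_diag A = 0 by rewrite raddf0 mulmx0 mul0mx.
apply/rowP => i; have := A0 (V ^t* *m delta_mx i 0).
rewrite [X in _ *m X *m _]spectral_decomp // -/V trmxC_mul trmxCK.
rewrite !mulmxA -(mulmxA _ V) VV mulmx1 -(mulmxA _ V) VV mulmx1.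
rewrite mul_mx_diag mxE (bigD1 i) //= big1 => [|j ji].
  by rewrite !mxE !eqxx /= rmorph1 mul1r mulr1 addr0 => ->.
by rewrite !mxE (negbTE ji) mulr0.
Qed.

Lemma psdmx_hermitian A : psdmx A -> A ^t* = A.
Proof.
move=> Apos; apply/eqP; rewrite eq_sym -subr_eq0; apply/eqP.
(* The difference of [A] and its adjoint is anti-Hermitian, hence normal, and its form at [v] is z
   minus the conjugate of z, where z is real. *)
apply: normal_quadratic_eq0 => [|v].
  apply/normalmxP; rewrite raddfB /= map_mxB trmxCK.
  by rewrite -opprB mulNmx mulmxN.
rewrite mulmxBr mulmxBl [LHS]mxE.
have -> : v ^t* *m A ^t* *m v = (v ^t* *m A *m v) ^t*.
  by rewrite !trmxC_mul trmxCK mulmxA.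
have cE (w : 'M[R[i]]_1) : (w ^t*) 0 0 = Num.conj (w 0 0) by rewrite !mxE.
by rewrite [X in _ + X]mxE cE conj_Creal ?subrr ?ger0_real.
Qed.

Lemma hermitian_normal A : A ^t* = A -> A \is normalmx.
Proof. by move=> Ah; apply/normalmxP; rewrite Ah. Qed.

Lemma psdmx_conj A B : psdmx A -> psdmx (B *m A *m B ^t*).
Proof.
move=> Apos v; have := Apos (B ^t* *m v).
by rewrite trmxC_mul trmxCK !mulmxA.
Qed.

Lemma psdmx_diag_ge0 A i : psdmx A -> 0 <= A i i.
Proof.
move=> /(_ (delta_mx i 0)); rewrite -colE 2!mxE (bigD1 i) //= big1 => [|j ji].
  by rewrite !mxE !eqxx rmorph1 mul1r addr0.
by rewrite !mxE (negbTE ji) rmorph0 mul0r.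
Qed.

Lemma diag_psdmx (d : 'rV[R[i]]_N) : (forall i, 0 <= d 0 i) ->
  psdmx (diag_mx d).
Proof.
move=> d0 v; rewrite mul_mx_diag mxE sumr_ge0 // => i _.
by rewrite !mxE mulrAC mulr_ge0 // mulrC mul_conjC_ge0.
Qed.

Lemma psdmx_spectral_diag_ge0 A i : psdmx A -> 0 <= spectral_diag A 0 i.
Proof.
move=> Apos; have An := hermitian_normal (psdmx_hermitian Apos).
have VV : spectralmx A *m (spectralmx A) ^t* = 1%:M.
  by apply/unitarymxP/spectral_unitarymx.
have := psdmx_diag_ge0 i (psdmx_conj (spectralmx A) Apos).
rewrite [X in (_ *m X *m _) i i]spectral_decomp // !mulmxA VV mul1mx.
by rewrite -mulmxA VV mulmx1 !mxE eqxx.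
Qed.

(** In an eigenbasis of [A] the trace is the sum of the diagonal entries of [M] weighted by the
    eigenvalues of [A], all nonnegative. *)
Lemma psdmx_trace_mul_ge0 M A : psdmx M -> psdmx A -> 0 <= \tr (M *m A).
Proof.
move=> Mpos Apos; have An := hermitian_normal (psdmx_hermitian Apos).
rewrite [X in M *m X]spectral_decomp // !mulmxA mxtrace_mulC !mulmxA.
rewrite mul_mx_diag; apply: sumr_ge0 => i _; rewrite mxE mulr_ge0 //.
  exact/psdmx_diag_ge0/psdmx_conj.
exact: psdmx_spectral_diag_ge0.
Qed.

Lemma psdmx_trace_mul_le M A :
  psdmx (1%:M - M) -> psdmx A -> \tr (M *m A) <= \tr A.
Proof.
move=> Mle Apos; have := psdmx_trace_mul_ge0 Mle Apos.
by rewrite mulmxBl mul1mx raddfB subr_ge0.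
Qed.

Lemma trace_norm_spectral A : A \is normalmx ->
  trace_norm A = complex.Re (\sum_i `|spectral_diag A 0 i|).
Proof.
move=> An; set d := spectral_diag A; set V := spectralmx A.
have VV : V *m V ^t* = 1%:M by apply/unitarymxP/spectral_unitarymx.
have Vu : V \in unitmx by exact: spectral_unit.
have Vi : invmx V = V ^t* by rewrite invmx_unitary // spectral_unitarymx.
(* The squared moduli of the eigenvalues of [A]: the same [V] diagonalizes the product of the
   adjoint of [A] with [A]. *)
pose e := \row_i (d 0 i * Num.conj (d 0 i)).
have sqA : A ^t* *m A = invmx V *m diag_mx e *m V.
  rewrite (spectral_decomp An) -/V -/d !trmxC_mul trmxCK !mulmxA Vi.
  rewrite -(mulmxA _ V) VV mulmx1; congr (_ *m _); rewrite -!mulmxA.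
  congr (_ *m _); apply/matrixP => i j.
  rewrite mul_mx_diag !mxE eq_sym; have [->|_] := eqVneq i j.
    by rewrite mulrC.
  by rewrite !mulr0n rmorph0 mul0r.
have Bn : A ^t* *m A \is normalmx.
  by apply: hermitian_normal; rewrite trmxC_mul trmxCK.
(* [sqrtmx] uses its own diagonalization of this product, a priori unrelated to [V]; [eB] equates
   the two so that the square root can be computed with [V] and [e]. *)
have /orthomx_spectralP eB := Bn; rewrite {1}sqA in eB.
rewrite /trace_norm /sqrtmx -(diag_similar_map sqrtC _ _ eB) ?spectral_unit //.
rewrite mxtrace_mulC mulmxA mulmxV // mul1mx mxtrace_diag.
by congr (complex.Re _); apply: eq_bigr => i _; rewrite !mxE normC_def.
Qed.

Lemma exists_positive_projector A : A ^t* = A ->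
  exists M, [/\ psdmx M, psdmx (1%:M - M) &
    complex.Re (\tr (M *m A)) = 2^-1 * (trace_norm A + complex.Re (\tr A))].
Proof.
move=> Ah; have An := hermitian_normal Ah.
set d := spectral_diag A; set V := spectralmx A.
have VV : V *m V ^t* = 1%:M by apply/unitarymxP/spectral_unitarymx.
have VV' : V ^t* *m V = 1%:M by apply: mulmx1C.
have dreal i : d 0 i \is Num.real.
  have Asym : A \is hermsymmx.
    by apply/is_hermitianmxP; rewrite expr0 scale1r Ah.
  by have /mxOverP -> := hermitian_spectral_diag_real Asym.
(* Spectral projector onto the eigenvalues satisfying [s]. The complement is again of this form, so
   [Ppos] gives both positivity claims. *)
pose P (s : pred R[i]) : 'M[R[i]]_N :=
  V ^t* *m diag_mx (\row_i (s (d 0 i))%:R) *m V.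
pose pos (x : R[i]) := 0 < x.
have Ppos s : psdmx (P s).
  have := @psdmx_conj (diag_mx (\row_i (s (d 0 i))%:R)) (V ^t*).
  by rewrite trmxCK; apply; apply: diag_psdmx => i; rewrite mxE ler0n.
have PC : 1%:M - P pos = P (predC pos).
  apply/eqP; rewrite subr_eq -mulmxDl -mulmxDr -raddfD /=.
  rewrite (_ : _ + _ = const_mx 1) ?diag_const_mx ?mulmx1 ?VV' //.
  by apply/rowP => i; rewrite !mxE /=; case: pos; rewrite ?addr0 ?add0r.
exists (P pos); split; rewrite ?PC //.
have trA : \tr A = \sum_i d 0 i.
  rewrite [in LHS](spectral_decomp An) mxtrace_mulC mulmxA VV mul1mx.
  by rewrite mxtrace_diag.
have trPA : \tr (P pos *m A) = \sum_i (pos (d 0 i))%:R * d 0 i.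
  rewrite [X in _ *m X](spectral_decomp An) -/V -/d /P !mulmxA.
  rewrite -(mulmxA _ V) VV mulmx1 mxtrace_mulC !mulmxA VV mul1mx.
  by rewrite mulmx_diag mxtrace_diag; apply: eq_bigr => i _; rewrite !mxE.
rewrite trace_norm_spectral // -raddfD trA trPA -big_split /=.
set S1 := \sum_i _; set S2 := \sum_i _.
(* |x| + x is 2x for x > 0 and 0 otherwise, so [S2] is twice the sum of the positive eigenvalues. *)
have -> : S2 = S1 + S1.
  rewrite -big_split; apply: eq_bigr => i _ /=.
  rewrite /pos; have [x0|x0] := real_ltP (real0 _) (dreal i).
    by rewrite gtr0_norm // mul1r.
  by rewrite ler0_norm // mul0r addNr addr0.
by rewrite raddfD /=; lra.
Qed.

End PositiveOperators.

(** * Discrimination of two states *)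

Lemma big_ord2 (V : nmodType) (F : 'I_2 -> V) :
  \sum_b F b = F ord0 + F ord_max.
Proof.
by rewrite big_ord_recl big_ord1; congr (_ + F _); apply: val_inj.
Qed.

Section TwoStateDiscrimination.
Variables (R : realType) (N : nat).
Implicit Types (p : 'I_2 -> R) (tau M : 'I_2 -> 'M[R[i]]_N).

Lemma Re_realM (x : R) (z : R[i]) : complex.Re (x%:C * z) = x * complex.Re z.
Proof. by case: z => a b /=; rewrite mul0r subr0. Qed.

Lemma Re_le (z w : R[i]) : z <= w -> complex.Re z <= complex.Re w.
Proof. by rewrite lecE => /andP[]. Qed.

Lemma success_probabilityE p tau M : success_probability p tau M =
  p ord0 * complex.Re (\tr (M ord0 *m tau ord0)) +
  p ord_max * complex.Re (\tr (M ord_max *m tau ord_max)).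
Proof. by rewrite /success_probability big_ord2 raddfD /= !Re_realM. Qed.

Lemma POVM_compl M b : POVM M -> psdmx (1%:M - M b).
Proof.
move=> [Mpos <-]; rewrite big_ord2.
have [->|->] : b = ord0 \/ b = ord_max.
- by case: b => [[|[|//]] ?]; [left|right]; apply: val_inj.
- by rewrite (addrC (M ord0)) addrK.
- by rewrite addrK.
Qed.

Lemma POVM_pair (A : 'M[R[i]]_N) : psdmx A -> psdmx (1%:M - A) ->
  POVM (fun b : 'I_2 => if b == ord0 then A else 1%:M - A).
Proof.
move=> A0 A1; split=> [b|]; first by case: ifP.
by rewrite big_ord2 /= addrC subrK.
Qed.

Lemma psdmx1 : psdmx (1%:M : 'M[R[i]]_N).
Proof.
by rewrite -diag_const_mx; apply: diag_psdmx => i; rewrite mxE ler01.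
Qed.

Lemma POVM_nonempty : ([set M | @POVM R N M] !=set0)%classic.
Proof.
have [A [A0 A1 _]] := exists_positive_projector (psdmx_hermitian psdmx1).
by exists (fun b => if b == ord0 then A else 1%:M - A); apply: POVM_pair.
Qed.

Lemma Re_trace_POVM_le M b (A : 'M[R[i]]_N) : POVM M -> psdmx A ->
  complex.Re (\tr (M b *m A)) <= complex.Re (\tr A).
Proof.
by move=> MP A0; apply/Re_le/psdmx_trace_mul_le => //; exact: POVM_compl.
Qed.

(** An element lies below [sup] only once the set is known to be bounded; here 1 is a bound, since
    each trace is at most the trace of a density operator. *)
Lemma success_probability_le_P_G p tau M :
  ensemble p tau -> POVM M -> success_probability p tau M <= P_G p tau.
Proof.
move=> [p0 p1 tauD] MP; apply: ub_le_sup; last by exists M.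
exists 1 => _ [M' M'P <-]; rewrite success_probabilityE -p1 big_ord2.
by apply: lerD; apply: ler_piMr => //;
  rewrite (le_trans (Re_trace_POVM_le _ M'P (tauD _).1)) // (tauD _).2.
Qed.

Lemma P_G_ge_trace_norm p tau : ensemble p tau ->
  2^-1 * (1 + trace_norm ((p ord0)%:C *: tau ord0
                          - (p ord_max)%:C *: tau ord_max)) <= P_G p tau.
Proof.
move=> ens; have [p0 p1 tauD] := ens; rewrite big_ord2 in p1.
set A := _ - _.
have Ah : (map_mx Num.conj A^T) = A.
  have tauh b := psdmx_hermitian (tauD b).1.
  rewrite raddfB /= map_mxB !linearZ /= !map_mxZ /= !tauh.
  by rewrite !conj_Creal ?complex_real.
have [M [M0 M1 trM]] := exists_positive_projector Ah.
apply: le_trans (success_probability_le_P_G ens (POVM_pair M0 M1)).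
(* As the states have trace 1, the pair [M], [1%:M - M] succeeds with probability [p ord_max] +
   Tr([M A]), while Tr [A] = [p ord0 - p ord_max]. *)
rewrite success_probabilityE /= mulmxBl mul1mx !raddfB /= (tauD _).2.
move: trM; rewrite /A mulmxBr !raddfB /= -!scalemxAr !linearZ /= !(tauD _).2.
by rewrite !Re_realM /= => trM; lra.
Qed.

Lemma P_G_white_noise p tau sigma (r : R) : 0 <= r -> ensemble p tau ->
  sigma ord0 = white_noise_mix (tau ord0) r -> sigma ord_max = tau ord_max ->
  P_G p sigma <= (P_G p tau + r) / (1 + r).
Proof.
move=> r0 ens sigma0 sigma1; have [p0 p1 tauD] := ens; rewrite big_ord2 in p1.
apply: ge_sup => [|_ [M MP <-]].
  by have [M MP] := POVM_nonempty; exists (success_probability p sigma M), M.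
have := success_probability_le_P_G ens MP.
rewrite !success_probabilityE sigma0 sigma1 /white_noise_mix.
rewrite -scalemxAr mulmxDr -scalemxAr !linearZ /= raddfD /= linearZ /=.
rewrite Re_realM raddfD /= Re_realM.
have := Re_trace_POVM_le ord_max MP (tauD ord_max).1; rewrite (tauD _).2.
have := Re_trace_POVM_le ord0 MP psdmx1; rewrite mxtrace1.
set x0 := complex.Re (\tr (M _ *m tau ord0)).
set x1 := complex.Re (\tr (M _ *m tau ord_max)).
set t := complex.Re (\tr (M _ *m 1%:M)) => tN x1_le1 G_ge.
have tle : r / N%:R * t <= r.
  (* In dimension 0 the quotient [r / N%:R] is 0 by convention; otherwise the trace of a POVM
     element is at most [N]. *)
  have [->|N0] := eqVneq N 0%N; first by rewrite invr0 mulr0 mul0r.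
  rewrite -mulrA ler_piMr // mulrC ler_pdivrMr ?ltr0n ?lt0n // mul1r.
  by rewrite (le_trans tN) // raddfMn.
(* Together the next two bounds say that [r] times the success probability with the first state
   replaced by white noise is at most [r]. *)
have := ler_wpM2l (p0 ord0) tle.
have := ler_wpM2l r0 (ler_wpM2l (p0 ord_max) (x1_le1 : x1 <= 1)).
rewrite ler_pdivlMr; last by lra.
have -> : p ord0 * ((1 + r)^-1 * (x0 + r / N%:R * t)) =
    p ord0 * (x0 + r / N%:R * t) / (1 + r) by rewrite mulrCA mulrC.
rewrite mulrDl divfK; last by lra.
have rE : r * p ord0 + r * p ord_max = r by rewrite -mulrDr p1 mulr1.
by move: (r / N%:R * t) => u h1 h2; lra.
Qed.

End TwoStateDiscrimination.

(** * Robustness, the closest ensemble and the final estimate *)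

Lemma random_robustness_ge0 (R : realType) m (dd : 'I_m -> nat) n
    (rho : operator R dd) : 0 <= random_robustness n rho.
Proof.
rewrite /random_robustness.
(* On the empty set [inf] takes the default value 0. *)
have [->|ne] := eqVneq (robustness_set n rho) classical_sets.set0.
  by rewrite inf0.
by apply: lb_le_inf => [|r []//]; exact/classical_sets.set0P.
Qed.

Lemma white_noise_mix0 (R : realType) N (A : 'M[R[i]]_N) :
  white_noise_mix A 0 = A.
Proof.
by rewrite /white_noise_mix addr0 invr1 mul0r scale0r addr0 scale1r.
Qed.

Lemma closest_ksep_id (R : realType) m (dd : 'I_m -> nat) n
    (rho : operator R dd) : ksep (m - n + 1) rho -> closest_ksep n rho = rho.
Proof.
(* Zero noise is already admissible, and it is the least value allowed. *)
move=> rhoS; rewrite /closest_ksep (@random_robustness_min _ _ _ _ _ 0).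
- exact: white_noise_mix0.
- by split=> //; rewrite white_noise_mix0.
- by move=> s [].
Qed.

Theorem theorem4 (R : realType) (m k n : nat) (dd : 'I_m -> nat)
    (p : 'I_2 -> R) (rho : 'I_2 -> operator R dd)
    (hk : (1 <= k <= m)%N) (hn : n = (m - k + 1)%N)
    (heta : ensemble p rho) (hrho2 : ksep k (rho ord_max))
    (R1 : R) (hR1 : R1 = random_robustness n (rho ord0)) :
  P_G p rho - P_G p (fun b => closest_ksep n (rho b)) >=
    2^-1 * R1 / (1 + R1) *
      (trace_norm ((p ord0)%:C *: rho ord0 - (p ord_max)%:C *: rho ord_max) - 1).
Proof.
(* Subtraction is truncated, so the bounds on [k] are what makes the passage from [k] to [n]
   invertible. *)
have mn : (m - n + 1)%N = k.
  by case/andP: hk => k0 km; rewrite hn !addn1 subnS subKn // prednK.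
have R0 : 0 <= R1 by rewrite hR1 random_robustness_ge0.
have sigma0 : closest_ksep n (rho ord0) = white_noise_mix (rho ord0) R1.
  by rewrite hR1.
have sigma1 : closest_ksep n (rho ord_max) = rho ord_max.
  by apply: closest_ksep_id; rewrite mn.
have := P_G_white_noise (sigma := fun b => closest_ksep n (rho b))
  R0 heta sigma0 sigma1.
have := P_G_ge_trace_norm heta.
set T := trace_norm _; set G := P_G p rho; set G' := P_G p _ => GT.
have R1_gt0 : 0 < 1 + R1 by lra.
(* With denominators cleared, [G'le] gives (G - G')(1 + R1) >= R1 (G - 1), and [GT] scaled by [R1]
   gives R1 (G - 1) >= R1 (T - 1) / 2. *)
rewrite ler_pdivlMr // mulrAC ler_pdivrMr // => G'le.
by have := ler_wpM2l R0 GT; lra.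
Qed.
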